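(* Let $G$ be a nontrivial finite group generated by elements $a,b$ such that the orders $|a|,|b|,|ab|$ are pairwise coprime. Let $\varphi:F_2\to G$ be the surjection sending the free generators $x,y$ to $a,b$ respectively. Then $\Gamma_{[\varphi]}$ is totally noncongruence.
   Context: $F_2$ is the free group on $x,y$; $[\varphi]$ is the class of $\varphi$ in $\mathrm{Surj}(F_2,G)/\mathrm{Inn}(G)$, on which $\mathrm{SL}_2(\mathbb{Z})\subset\mathrm{GL}_2(\mathbb{Z})\cong\mathrm{Out}(F_2)$ acts by precomposition with outer automorphisms; $\Gamma_{[\varphi]}$ is the stabilizer of $[\varphi]$ in $\mathrm{SL}_2(\mathbb{Z})$. For a finite index subgroup $\Gamma\le\mathrm{SL}_2(\mathbb{Z})$, $\pm\Gamma$ is the subgroup generated by $\Gamma$ and $-I$, and the (geometric) level $l$ of $\Gamma$ is the least common multiple of its cusp widths (the cycle lengths of $\begin{pmatrix}1&1\\0&1\end{pmatrix}$ acting on $\mathrm{SL}_2(\mathbb{Z})/\pm\Gamma$). Let $p_l:\mathrm{SL}_2(\mathbb{Z})\to\mathrm{SL}_2(\mathbb{Z}/l\mathbb{Z})$ be reduction and $e:=[\mathrm{SL}_2(\mathbb{Z}/l\mathbb{Z}):p_l(\pm\Gamma)]$. $\Gamma$ is congruence if it contains $\ker(\mathrm{SL}_2(\mathbb{Z})\to\mathrm{SL}_2(\mathbb{Z}/n\mathbb{Z}))$ for some $n\ge1$, otherwise noncongruence. $\Gamma$ is totally noncongruence if it is noncongruence and $e=1$. *)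

(* Defs.v *)
From HB Require Import structures.
From mathcomp Require Import all_boot all_order all_algebra all_fingroup.
From mathcomp Require Import boolp classical_sets functions cardinality fsbigop.

Set Implicit Arguments.
Unset Strict Implicit.
Unset Printing Implicit Defensive.

Import GRing.Theory.

(** * Free groups *)

Section FreeGroup.
Local Open Scope group_scope.
Variable I : choiceType.

(* The letter (i, false) is the generator i, and (i, true) is its inverse. *)
Definition letter : Type := (I * bool)%type.
Definition linv (l : letter) : letter := (l.1, ~~ l.2).
Definition reduced (s : seq letter) : bool := sorted (fun l m => m != linv l) s.

Record free_group := FreeGroup {
  free_word : seq letter;
  free_wordP : reduced free_word
}.

HB.instance Definition _ := [isSub for free_word].
HB.instance Definition _ := [Choice of free_group by <:].

Definition cons_red (l : letter) (s : seq letter) : seq letter :=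
  if s is m :: s' then if m == linv l then s' else l :: s else [:: l].

Definition wmul (s t : seq letter) : seq letter := foldr cons_red t s.
Definition winv (s : seq letter) : seq letter := rev (map linv s).

Lemma linvK : involutive linv.
Proof. by case=> i e; rewrite /linv /= negbK. Qed.

Lemma linv_neq l : l != linv l.
Proof. by case: l => i []; rewrite xpair_eqE andbF. Qed.

Lemma reduced_behead l s : reduced (l :: s) -> reduced s.
Proof. exact: path_sorted. Qed.

Lemma cons_red_reduced l s : reduced s -> reduced (cons_red l s).
Proof.
case: s => [//|m s] /= rs; case: eqP => [_|/eqP nml]; first exact: path_sorted rs.
by rewrite /reduced /= nml.
Qed.

Lemma cons_redK l s : reduced s -> cons_red (linv l) (cons_red l s) = s.
Proof.
case: s => [|m s] /= rs; first by rewrite linvK eqxx.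
case: eqP => [eml|_] /=; last by rewrite linvK eqxx.
by case: s rs => [|k s] /=; rewrite eml // => /andP[/negPf-> _].
Qed.

Lemma wmul_reduced s t : reduced t -> reduced (wmul s t).
Proof. by move=> rt; elim: s => //= l s; apply: cons_red_reduced. Qed.

Lemma wmul_cons_red l s t : reduced s -> reduced t ->
  wmul (cons_red l s) t = cons_red l (wmul s t).
Proof.
case: s => [//|m s] /= rs rt; case: eqP => [->|//] /=.
by rewrite -{1}[l]linvK cons_redK // wmul_reduced.
Qed.

Lemma wmulA s t u : reduced t -> reduced u ->
  wmul s (wmul t u) = wmul (wmul s t) u.
Proof.
move=> rt ru; elim: s => //= l s ->.
by rewrite wmul_cons_red // wmul_reduced.
Qed.

Lemma wmul1 s : reduced s -> wmul s [::] = s.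
Proof.
elim: s => //= l s IHs rs; rewrite IHs ?(reduced_behead rs) //.
by case: s rs {IHs} => //= m s /andP[/negPf-> _].
Qed.

Lemma winv_reduced s : reduced s -> reduced (winv s).
Proof.
rewrite /reduced /winv rev_sorted sorted_map; apply: sub_sorted => l m /=.
by apply: contra => /eqP->; rewrite !linvK.
Qed.

Lemma wmulV s : reduced s -> wmul (winv s) s = [::].
Proof.
rewrite /winv; elim: s => //= l s IHs rs; rewrite rev_cons -cats1.
rewrite /wmul foldr_cat /= linvK eqxx.
exact: IHs (reduced_behead rs).
Qed.

Definition free_one := @FreeGroup [::] isT.
Definition free_mul (u v : free_group) :=
  FreeGroup (wmul_reduced (free_word u) (free_wordP v)).
Definition free_inv (u : free_group) := FreeGroup (winv_reduced (free_wordP u)).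

Lemma free_mulA : associative free_mul.
Proof. by move=> u v w; apply/val_inj/wmulA; apply: free_wordP. Qed.
Lemma free_mul1g : left_id free_one free_mul.
Proof. by move=> u; apply: val_inj. Qed.
Lemma free_mulg1 : right_id free_one free_mul.
Proof. by move=> u; apply/val_inj/wmul1/free_wordP. Qed.
Lemma free_mulVg : left_inverse free_one free_inv free_mul.
Proof. by move=> u; apply/val_inj/wmulV/free_wordP. Qed.
Lemma free_mulgV : right_inverse free_one free_inv free_mul.
Proof.
move=> u; have uK : free_inv (free_inv u) = u.
  rewrite -[LHS]free_mulg1 -(free_mulVg u) free_mulA.
  by rewrite free_mulVg free_mul1g.
by rewrite -{1}uK free_mulVg.
Qed.

HB.instance Definition _ := isGroup.Build free_group
  free_mulA free_mul1g free_mulg1 free_mulVg free_mulgV.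

Definition gen (i : I) : free_group := @FreeGroup [:: (i, false)] isT.

(* Universal property. *)
Section Lift.
Variables (H : groupType) (f : I -> H).

Definition lift_letter (l : letter) : H := if l.2 then (f l.1)^-1 else f l.1.
Definition free_lift (u : free_group) : H :=
  foldr (fun l h => lift_letter l * h) 1 (free_word u).

Lemma free_lift_mul : {morph free_lift : u v / u * v}.
Proof.
have liftV l : lift_letter (linv l) = (lift_letter l)^-1.
  by case: l => i []; rewrite /lift_letter /= ?invgK.
move=> [s rs] [t rt]; rewrite /free_lift /= {rs rt}.
elim: s => [|l s IHs] /=; first by rewrite mul1g.
rewrite -mulgA -IHs; case: (wmul s t) => [//|m r] /=.
by case: eqP => [->|//]; rewrite liftV mulgA mulgV mul1g.
Qed.

HB.instance Definition _ := isMultiplicative.Build _ _ free_lift free_lift_mul.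

Lemma free_lift_gen i : free_lift (gen i) = f i.
Proof. exact: mulg1. Qed.

Lemma free_lift_uniq (h : {multiplicative free_group -> H}) :
  (forall i, h (gen i) = f i) -> h =1 free_lift.
Proof.
move=> hf.
have h1 : h 1 = 1 by apply: (mulgI (h 1)); rewrite -gmulfM !mulg1.
have hl l : h (@FreeGroup [:: l] isT) = lift_letter l.
  case: l => i [] /=; last exact: hf.
  rewrite /lift_letter /= -hf; apply: (mulgI (h (gen i))).
  by rewrite mulgV -gmulfM -h1; congr (h _); apply: val_inj; rewrite /= eqxx.
case=> s; elim: s => [|l s IHs] rs.
  by rewrite /free_lift /= -h1; congr (h _); apply: val_inj.
rewrite /free_lift /= -hl -[foldr _ _ s](IHs (reduced_behead rs)) -gmulfM.
congr (h _); apply: val_inj => /=.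
by case: s rs {IHs} => //= m s /andP[/negPf-> _].
Qed.

End Lift.

Local Open Scope ring_scope.
(* The coordinate at i of the image of u in the abelianization, i.e., the sum of
   the exponents of the generator i in u. *)
Definition expsum (i : I) (u : free_group) : int :=
  \sum_(l <- free_word u | l.1 == i) (-1) ^+ l.2.

End FreeGroup.

Arguments gen {I} i.

Notation F2 := (free_group 'I_2).
Definition genx : F2 := gen 0%R.
Definition geny : F2 := gen 1%R.

(* The action of an endomorphism on the abelianization Z^2 of F2: its j-th
   column is the image of the j-th basis vector. On automorphisms, this induces
   the isomorphism from Out(F2) to GL_2(Z). *)
Definition ab_mx (s : {multiplicative F2 -> F2}) : 'M[int]_2 :=
  (\matrix_(i, j) expsum i (s (gen j)))%R.

(** * The ring Z/n *)

(* 'Z_n is not used because it denotes Z/2 when n = 1, whereas zmod 1 is the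
   zero ring; zmod n is meaningful for 0 < n only. *)
Definition zmod (n : nat) : Type := 'I_n.-1.+1.

HB.instance Definition _ n := Finite.on (zmod n).
HB.instance Definition _ n := GRing.Zmodule.on (zmod n).
HB.instance Definition _ n := GRing.Zmodule_isComPzRing.Build (zmod n)
  (@Zp_mulA _) (@Zp_mulC _) (@Zp_mul1z _) (@Zp_mul_addl _).

(** * The group SL_2 *)

Section SL2.
Local Open Scope ring_scope.

Record SL2 (R : comPzRingType) := MkSL2 {
  slmx :> 'M[R]_2;
  slmxP : \det slmx == 1
}.

HB.instance Definition _ (R : comPzRingType) := [isSub for @slmx R].
HB.instance Definition _ (R : comPzRingType) := [Choice of SL2 R by <:].

Section Group.
Variable R : comPzRingType.

Fact sl_one_subproof : \det (1%:M : 'M[R]_2) == 1.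
Proof. by rewrite det1. Qed.
Definition sl_one : SL2 R := MkSL2 sl_one_subproof.

Fact sl_mul_subproof (A B : SL2 R) : \det (A *m B) == 1.
Proof. by rewrite det_mulmx (eqP (slmxP A)) (eqP (slmxP B)) mulr1. Qed.
Definition sl_mul (A B : SL2 R) : SL2 R := MkSL2 (sl_mul_subproof A B).

Fact sl_inv_subproof (A : SL2 R) : \det (\adj A) == 1.
Proof.
have := congr1 determinant (mul_mx_adj A).
by rewrite det_mulmx (eqP (slmxP A)) mul1r det1 => ->.
Qed.
Definition sl_inv (A : SL2 R) : SL2 R := MkSL2 (sl_inv_subproof A).

Lemma sl_mulA : associative sl_mul.
Proof. by move=> A B C; apply/val_inj/mulmxA. Qed.
Lemma sl_mul1g : left_id sl_one sl_mul.
Proof. by move=> A; apply/val_inj/mul1mx. Qed.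
Lemma sl_mulg1 : right_id sl_one sl_mul.
Proof. by move=> A; apply/val_inj/mulmx1. Qed.
Lemma sl_mulVg : left_inverse sl_one sl_inv sl_mul.
Proof. by move=> A; apply: val_inj; rewrite /= mul_adj_mx (eqP (slmxP A)). Qed.
Lemma sl_mulgV : right_inverse sl_one sl_inv sl_mul.
Proof. by move=> A; apply: val_inj; rewrite /= mul_mx_adj (eqP (slmxP A)). Qed.

HB.instance Definition _ := isGroup.Build (SL2 R)
  sl_mulA sl_mul1g sl_mulg1 sl_mulVg sl_mulgV.

Fact slN1_subproof : \det (- 1%:M : 'M[R]_2) == 1.
Proof. by rewrite -scaleN1r detZ det1 mulr1 sqrrN expr1n. Qed.
Definition slN1 : SL2 R := MkSL2 slN1_subproof.

(* The matrix with rows (1, 1) and (0, 1) *)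
Fact slT_subproof : \det (1%:M + delta_mx 0 1 : 'M[R]_2) == 1.
Proof.
rewrite -det_tr det_trig; last first.
  by apply/is_trig_mxP => -[[|[|//]] ?] [[|[|//]] ?] //= _; rewrite !mxE /= addr0.
by rewrite big_ord_recl big_ord1 !mxE /= !addr0 mulr1.
Qed.
Definition slT : SL2 R := MkSL2 slT_subproof.

End Group.

HB.instance Definition _ (R : finComPzRingType) := [Finite of SL2 R by <:].

Notation SL2Z := (SL2 int).

Fact sl_red_subproof n (A : SL2Z) :
  \det (map_mx (fun z : int => z%:~R : zmod n) A) == 1.
Proof. by rewrite (det_map_mx (@intmul (zmod n) 1)) (eqP (slmxP A)) rmorph1. Qed.
Definition sl_red n (A : SL2Z) : SL2 (zmod n) := MkSL2 (sl_red_subproof n A).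

End SL2.

Notation SL2Z := (SL2 int).

(** * Subgroups of SL_2(Z) *)

Section Subgroups.
Local Open Scope classical_set_scope.
Local Open Scope group_scope.

Definition subgroup (G : groupType) (H : set G) : Prop :=
  H 1 /\ forall g h, H g -> H h -> H (g * h^-1).

Definition left_coset (G : groupType) (g : G) (H : set G) : set G :=
  [set g * h | h in H].

Definition finite_index_subgroup (G : groupType) (H : set G) : Prop :=
  subgroup H /\ finite_set [set left_coset g H | g in [set: G]].

(* The subgroup generated by Gamma and -I *)
Definition pm (Gamma : set SL2Z) : set SL2Z :=
  smallest (@subgroup SL2Z) (Gamma `|` [set slN1 int]).

(* The lengths of the cycles of slT acting by left translation on the left
   cosets of pm Gamma *)
Definition cusp_widths (Gamma : set SL2Z) : set nat :=
  [set w | exists g : SL2Z,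
    [/\ (0 < w)%N,
        left_coset (slT int ^+ w * g) (pm Gamma) = left_coset g (pm Gamma)
      & forall k, (0 < k < w)%N ->
        left_coset (slT int ^+ k * g) (pm Gamma) <> left_coset g (pm Gamma)]].

(* The big operator is meaningful when there are finitely many cusp widths, in
   particular when Gamma has finite index; it is 1 otherwise. *)
Definition level (Gamma : set SL2Z) : nat :=
  \big[lcmn/1%N]_(w \in cusp_widths Gamma) w.

Definition red_pm (n : nat) (Gamma : set SL2Z) : {set SL2 (zmod n)} :=
  [set A | `[< exists2 g, pm Gamma g & sl_red n g = A >]]%SET.

Definition level_index (Gamma : set SL2Z) : nat :=
  #|[set: SL2 (zmod (level Gamma))]%SET : red_pm (level Gamma) Gamma|.

Definition congruence (Gamma : set SL2Z) : Prop :=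
  finite_index_subgroup Gamma /\
  exists2 n, (0 < n)%N & forall g, sl_red n g = 1 -> Gamma g.

Definition noncongruence (Gamma : set SL2Z) : Prop :=
  finite_index_subgroup Gamma /\ ~ congruence Gamma.

Definition totally_noncongruence (Gamma : set SL2Z) : Prop :=
  noncongruence Gamma /\ level_index Gamma = 1%N.

(* The class of phi modulo the inner automorphisms of G *)
Definition inn_class (G : groupType) (phi : F2 -> G) : set (F2 -> G) :=
  [set psi | exists g : G, forall u, psi u = phi u ^ g].

(* The stabilizer in SL_2(Z) of the class of phi: the image, under the
   isomorphism from Out(F2) to GL_2(Z) induced by ab_mx, of the outer
   automorphisms of determinant 1 which fix this class by precomposition. *)
Definition stab_class (G : groupType) (phi : F2 -> G) : set SL2Z :=
  [set g | exists s : {multiplicative F2 -> F2},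
    [/\ bijective s, ab_mx s = g & inn_class (phi \o s) = inn_class phi]].

End Subgroups.

(* Main.v *)
(* Precomposing [phi] with powers of the transvections of F2 that fix [x], [y]
   and [x * y] shows that the stabilizer contains the powers of exponents #[a],
   #[b] and #[a * b] of three conjugate unipotent matrices. Since at each prime
   at most one of these exponents is not invertible, and two of the unipotents
   generate the third, the stabilizer maps onto SL_2(Z/n) for every n. Hence it
   is all of SL_2(Z) if it is a congruence subgroup. But then it contains the
   class of (x, y) |-> (x, x * y), so that [b] and [a * b] are conjugate, and
   their orders are both coprime and equal; thus a = b = 1.

   The last step needs Nielsen's theorem that an automorphism of F2 which is
   trivial on the abelianization is inner. A basis that does not satisfy
   Nielsen's cancellation conditions is shortened by an elementary move,
   possibly followed by a conjugation, and a basis which does satisfy them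
   consists of two letters. So every basis is obtained from (x, y) by elementary
   moves, which are put into a normal form that is determined, up to
   conjugation, by the matrix. *)
Require Import Defs.
From HB Require Import structures.
From mathcomp Require Import all_boot all_fingroup all_order all_algebra.
From mathcomp Require Import boolp classical_sets functions cardinality.
From mathcomp Require Import ring zify.

Set Implicit Arguments.
Unset Strict Implicit.
Unset Printing Implicit Defensive.

Import GRing.Theory.
Local Open Scope group_scope.

(** * Common prefixes of sequences *)

Fixpoint lcp (T : eqType) (s t : seq T) : nat :=
  match s, t with
  | a :: s', b :: t' => if a == b then (lcp s' t').+1 else 0
  | _, _ => 0
  end.

Section Lcp.
Variable T : eqType.
Implicit Types s t r : seq T.

Lemma lcpC s t : lcp s t = lcp t s.
Proof. by elim: s t => [|a s IHs] [|b t] //=; rewrite eq_sym IHs. Qed.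

Lemma lcp_sizel s t : (lcp s t <= size s)%N.
Proof.
by elim: s t => [|a s IHs] [|b t] //=; case: eqP => //= _; apply: IHs.
Qed.

(** Two sequences agree at least as far as both agree with a third. This tree property drives all
    the cancellation arguments below. *)
Lemma lcp_ultra s t r : (minn (lcp s r) (lcp r t) <= lcp s t)%N.
Proof.
elim: s r t => [|a s IHs] [|c r] [|b t] //=; rewrite ?minn0 ?min0n //.
case: eqP => [->|_]; last by rewrite min0n.
by case: eqP => _; rewrite ?minn0 // minnSS ltnS.
Qed.

Lemma lcp_nth x0 s t i : nth x0 s i != nth x0 t i -> (lcp s t <= i)%N.
Proof.
elim: s t i => [|a s IHs] [|b t] [|i] //=; first by move/negPf->.
by case: (a =P b) => // _ ne; rewrite ltnS; apply: IHs.
Qed.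

End Lcp.

(** * Length and cancellation in free groups *)

Section FreeGroupLength.
Variable I : choiceType.
Implicit Types (g h : free_group I) (l m : letter I) (s t r : seq (letter I)).

Definition len g : nat := size (free_word g).
(* The Gromov product in the Cayley tree *)
Definition gprod g h : nat := lcp (free_word g) (free_word h).
Definition flet l : free_group I := @FreeGroup I [:: l] isT.

Lemma wmul_cat s t : reduced (s ++ t) -> wmul s t = s ++ t :> seq (letter I).
Proof.
elim: s => //= l s IHs rst; rewrite IHs ?(reduced_behead rst) //.
by case: (s ++ t) rst => //= m r /andP[/negPf-> _].
Qed.

(** What cancels between the inverse of [s] and [t] is exactly their common prefix, and each common
    letter removes two letters. *)
Lemma size_wmul_winv s t : reduced s -> reduced t ->
  (size (wmul (winv s) t) + 2 * lcp s t = size s + size t)%N.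
Proof.
have size_winv r : size (winv r) = size r :> nat by rewrite size_rev size_map.
elim: s t => [|l s IHs] [|m t] rs rt; rewrite /= ?muln0 ?addn0 //.
  by rewrite wmul1 ?size_winv // winv_reduced.
case: eqP => [lm|/eqP nlm].
  rewrite -lm in rt *.
  have -> : wmul (winv (l :: s)) (l :: t) = wmul (winv s) t.
    rewrite /winv /= rev_cons -cats1 /wmul foldr_cat /= linvK.
    by rewrite eqxx.
  have := IHs t (reduced_behead rs) (reduced_behead rt); lia.
rewrite wmul_cat; first by rewrite size_cat size_winv /=; lia.
rewrite /winv /= rev_cons cat_rcons /reduced.
have := winv_reduced rs; rewrite /winv /= rev_cons /reduced.
case: (rev _) => [|k r] /=; first by rewrite /= linvK eq_sym nlm.
by rewrite rcons_path cat_path /= linvK => /andP[-> ->]; rewrite eq_sym nlm.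
Qed.

Arguments len g%_g.
Arguments gprod (g h)%_g.

Lemma lenVM g h : (len (g^-1 * h) + 2 * gprod g h = len g + len h)%N.
Proof. by apply: size_wmul_winv; apply: free_wordP. Qed.

Lemma len_eq0 g : len g = 0%N -> g = 1.
Proof. by move/size0nil => g0; apply: val_inj. Qed.

Lemma lenV g : len g^-1 = len g.
Proof. by rewrite /len /= size_rev size_map. Qed.

Lemma lenM g h : (len (g * h) + 2 * gprod g^-1 h = len g + len h)%N.
Proof. by have := lenVM g^-1 h; rewrite invgK lenV. Qed.

Lemma gprodC g h : gprod g h = gprod h g.
Proof. exact: lcpC. Qed.

Lemma gprod_lel g h : (gprod g h <= len g)%N.
Proof. exact: lcp_sizel. Qed.

Lemma gprod_ultra k g h : (minn (gprod g k) (gprod k h) <= gprod g h)%N.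
Proof. exact: lcp_ultra. Qed.

Lemma prefix_ex g k : (k <= len g)%N -> exists2 p, len p = k & gprod p g = k.
Proof.
case: g => s rs; rewrite /len /gprod /= => ks.
have rp : reduced (take k s).
  by rewrite -(cat_take_drop k s) in rs; case/cat_sorted2: rs.
exists (FreeGroup rp) => /=; first by rewrite size_takel.
by elim: s k ks {rs rp} => [|l s IHs] [|k] //= ks; rewrite eqxx IHs.
Qed.

(** By [lenM], this amounts to [g * g] being longer than [g]. *)
Lemma gprodV_half g : g != 1 -> (2 * gprod g g^-1 < len g)%N.
Proof.
move=> g1; have lg : (0 < len g)%N.
  by rewrite lt0n; apply: contra g1 => /eqP/len_eq0/eqP.
case: g lg {g1} => s rs; rewrite /len /gprod /= => s0.
have l : letter I by case: s s0 {rs}.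
have half := odd_double_half (size s).-1.
(* The words [s] and [winv s] differ at the position just before the middle. *)
suff : (lcp s (winv s) <= (size s).-1./2)%N by lia.
apply: (@lcp_nth _ l).
have i_lt : ((size s).-1./2 < size s)%N by lia.
rewrite /winv nth_rev size_map // (nth_map l); last lia.
(* In odd length the middle letter would be its own inverse; in even length the two middle letters
   would be mutually inverse, contrary to reducedness. *)
case E: (odd (size s)).
  suff -> : (size s - (size s).-1./2.+1 = (size s).-1./2)%N by apply: linv_neq.
  by lia.
have -> : (size s - (size s).-1./2.+1 = (size s).-1./2.+1)%N by lia.
have i1 : ((size s).-1./2.+1 < size s)%N by lia.
have /(sortedP l)/(_ _ i1) := rs.
by apply: contra => /eqP {1}->; rewrite linvK.
Qed.

Lemma flet_gen i e : flet (i, e) = if e then (gen i)^-1 else gen i.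
Proof. by case: e; apply: val_inj. Qed.

Lemma free_consE l s (rls : reduced (l :: s)) :
  FreeGroup rls = flet l * FreeGroup (reduced_behead rls).
Proof.
by apply: val_inj; rewrite /= -[cons_red _ _]/(wmul [:: l] s) wmul_cat.
Qed.

Lemma free_ind (P : free_group I -> Prop) :
  P 1 -> (forall l g, P g -> P (flet l * g)) -> forall g, P g.
Proof.
move=> P1 PM [s]; elim: s => [|l s IHs] rs.
  by rewrite (_ : FreeGroup rs = 1) //; apply: val_inj.
by rewrite free_consE; apply: PM.
Qed.

End FreeGroupLength.
Arguments len {I} g%_g.
Arguments gprod {I} (g h)%_g.

(** * Group morphisms, and morphisms given by a pair of images *)

Section Morphisms.
Variables (G H : groupType) (f : {multiplicative G -> H}).

Lemma multM g h : f (g * h) = f g * f h. Proof. exact: gmulfM. Qed.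

Lemma mult1 : f 1 = 1.
Proof. by apply: (mulgI (f 1)); rewrite -multM !mulg1. Qed.

Lemma multV g : f g^-1 = (f g)^-1.
Proof. by apply: (mulgI (f g)); rewrite -multM !mulgV mult1. Qed.

Lemma multJ g h : f (g ^ h) = f g ^ f h.
Proof. by rewrite /conjg !multM multV. Qed.

Lemma multX g n : f (g ^+ n) = f g ^+ n.
Proof. by elim: n => [|n IHn]; rewrite ?mult1 // !expgS multM IHn. Qed.

End Morphisms.

Section Lift2.
Variable H : groupType.

Definition pairf (p : H * H) (i : 'I_2) : H := if i == 0%R then p.1 else p.2.
Definition lift2 (p : H * H) : {multiplicative F2 -> H} := free_lift (pairf p).

Lemma lift2x p : lift2 p genx = p.1. Proof. exact: free_lift_gen. Qed.
Lemma lift2y p : lift2 p geny = p.2. Proof. exact: free_lift_gen. Qed.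

End Lift2.

Lemma eq_mult (H : groupType) (f g : {multiplicative F2 -> H}) :
  f genx = g genx -> f geny = g geny -> f =1 g.
Proof.
move=> fgx fgy u.
pose fgen i := g (gen i).
rewrite (@free_lift_uniq _ _ fgen f) ?(@free_lift_uniq _ _ fgen g) // /fgen.
case=> [[|[|//]] i_lt].
  by rewrite (_ : gen _ = genx) //; congr gen; apply: val_inj.
by rewrite (_ : gen _ = geny) //; congr gen; apply: val_inj.
Qed.

Lemma eq_mult_id (f : {multiplicative F2 -> F2}) :
  f genx = genx -> f geny = geny -> f =1 id.
Proof. exact: (eq_mult (g := idfun)). Qed.

(** * Elementary moves on pairs and their normal form *)

Section Pairs.
Variable G : groupType.
Implicit Types (p : G * G) (g h : G).

Definition sgnV (e : bool) g := if e then g^-1 else g.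
Definition sact (s e f : bool) p :=
  let q := (sgnV e p.1, sgnV f p.2) in if s then (q.2, q.1) else q.
(** Both moves only multiply, so that words positive in two given letters stay positive;
    [standard_ab1] relies on this. *)
Definition lract (b : bool) p :=
  if b then (p.1 * p.2, p.2) else (p.1, p.1 * p.2).
Definition jact h p := (p.1 ^ h, p.2 ^ h).

Lemma jactM g h p : jact g (jact h p) = jact (h * g) p.
Proof. by rewrite /jact /= !conjgM. Qed.

Lemma jact1 p : jact 1 p = p.
Proof. by case: p => u v; rewrite /jact /= !conjg1. Qed.

Lemma sactJ s e f h p : sact s e f (jact h p) = jact h (sact s e f p).
Proof. by case: p s e f => u v [] [] []; rewrite /sact /jact /= -?conjVg. Qed.

Lemma lractJ b h p : lract b (jact h p) = jact h (lract b p).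
Proof. by case: p b => u v []; rewrite /lract /jact /= -?conjMg. Qed.

End Pairs.

(* On matrices, this is the normal form A * L1 * ... * Lk * B, where A and B are
   signed permutations and the Li are elementary with nonnegative entries: a
   left factor acts on the letters x, y, and a right factor on the pair. *)
Definition standard (p : F2 * F2) : Prop :=
  exists s e f (P : seq bool) s' e' f' h,
    p = jact h (sact s' e' f' (foldr (@lract _) (sact s e f (genx, geny)) P)).

Ltac gnorm := rewrite /conjg
  ?(invMg, invgK, mulgA, mulgK, mulgVK, mulVg, mulgV, mul1g, mulg1, invg1).

Lemma standardJ h p : standard p -> standard (jact h p).
Proof.
case=> s [e [f [P [s' [e' [f' [k ->]]]]]]].
by rewrite jactM; exists s, e, f, P, s', e', f', (k * h).
Qed.

Lemma standardJV h p : standard (jact h p) -> standard p.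
Proof. by move=> /(standardJ h^-1); rewrite jactM mulgV jact1. Qed.

Lemma sact_comp (G : groupType) (s e f s' e' f' : bool) :
  exists s1 e1 f1, forall p : G * G,
    sact s' e' f' (sact s e f p) = sact s1 e1 f1 p.
Proof.
exists (s (+) s'), (e (+) (if s then f' else e')).
exists (f (+) (if s then e' else f')) => -[u v].
by case: s e f s' e' f' => [] [] [] [] [] []; rewrite /sact /= ?invgK.
Qed.

Lemma sactK (G : groupType) s e f (p : G * G) :
  sact s (if s then f else e) (if s then e else f) (sact s e f p) = p.
Proof. by case: p => u v; case: s e f => [] [] []; rewrite /sact /= ?invgK. Qed.

Lemma standard_sact s e f p : standard p -> standard (sact s e f p).
Proof.
case=> s1 [e1 [f1 [P [s' [e' [f' [k ->]]]]]]]; rewrite sactJ.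
have [s2 [e2 [f2 ->]]] := sact_comp F2 s' e' f' s e f.
by exists s1, e1, f1, P, s2, e2, f2, k.
Qed.

Lemma standard_pos s e f P :
  standard (foldr (@lract _) (sact s e f (genx, geny)) P).
Proof.
exists s, e, f, P, false, false, false, 1; rewrite jact1.
by case: (foldr _ _ _).
Qed.

Lemma standard_of k s e f q p :
  standard q -> jact k p = sact s e f q -> standard p.
Proof.
by move=> std_q E; apply: (@standardJV k); rewrite E; apply: standard_sact.
Qed.

Definition lractV (G : groupType) (b : bool) (p : G * G) :=
  if b then (p.1 * p.2^-1, p.2) else (p.1, p.1^-1 * p.2).

(** Inverting the entry that serves as multiplier, before and after a move, inverts the move. *)
Lemma lractV_sact (G : groupType) b (p : G * G) :
  lractV b p = sact false (~~ b) b (lract b (sact false (~~ b) b p)).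
Proof. by case: b p => [] [u v]; rewrite /sact /= ?invgK. Qed.

(* The key relation is R L^-1 = L S with S a signed permutation. *)
Lemma standard_lractV_pos b s e f P :
  standard (lractV b (foldr (@lract _) (sact s e f (genx, geny)) P)).
Proof.
case: P => [|c P] /=.
  rewrite lractV_sact; apply: standard_sact.
  have [s1 [e1 [f1 ->]]] := sact_comp F2 s e f false (~~ b) b.
  exact: (standard_pos s1 e1 f1 [:: b]).
have := standard_pos s e f (~~ c :: P); have := standard_pos s e f P.
rewrite /=; case: (foldr _ _ _) => u v std_uv.
case: b c => [] [] /= std_c.
- by rewrite /lractV /= mulgK.
- apply: (@standard_of (u * v) true false true _ _ std_c).
  by rewrite /jact /sact /=; gnorm.
- apply: (@standard_of (v^-1 * u^-1) true true false _ _ std_c).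
  by rewrite /jact /sact /=; gnorm.
- by rewrite /lractV /= mulKg.
Qed.

(** A swap exchanges the two moves and unequal signs invert them; the conjugation restores the order
    of the factors where it gets reversed. *)
Lemma lract_sact (G : groupType) b s e f (p : G * G) :
  exists h, jact h (lract b (sact s e f p)) =
    sact s e f ((if e == f then @lract G else @lractV G) (b (+) s) p).
Proof.
case: p => u v; case: b s e f => [] [] [] [];
  rewrite /jact /sact /lractV /=;
  first [ exists 1; gnorm; reflexivity | exists u; gnorm; reflexivity
        | exists u^-1; gnorm; reflexivity | exists v; gnorm; reflexivity
        | exists v^-1; gnorm; reflexivity ].
Qed.

(** The move is pushed through the outer signed permutation, where it either extends the positive
    part or falls under [standard_lractV_pos]. *)
Lemma standard_lract b p : standard p -> standard (lract b p).
Proof.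
case=> s [e [f [P [s' [e' [f' [k ->]]]]]]]; rewrite lractJ; apply: standardJ.
set q := foldr _ _ P; have [h /standard_of] := lract_sact b s' e' f' q.
apply; case: ifP => _; last exact: standard_lractV_pos.
exact: (standard_pos s e f (_ :: P)).
Qed.

Lemma standard_lractV b p : standard p -> standard (lractV b p).
Proof.
move=> std_p; rewrite lractV_sact.
exact/standard_sact/standard_lract/standard_sact.
Qed.

(** * Generating pairs *)

Definition generating (p : F2 * F2) : Prop := forall g, exists t, lift2 p t = g.

Lemma lift2_comp (H : groupType) (f : {multiplicative F2 -> H}) p t :
  f (lift2 p t) = lift2 (f p.1, f p.2) t.
Proof.
apply: (@eq_mult H (f \o lift2 p : {multiplicative F2 -> H})) => /=.
  by rewrite !lift2x.
by rewrite !lift2y.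
Qed.

Lemma generating_trans p q : generating p ->
  (exists t, lift2 q t = p.1) -> (exists t, lift2 q t = p.2) -> generating q.
Proof.
move=> gen_p [t1 E1] [t2 E2] g; have [t <-] := gen_p g.
by exists (lift2 (t1, t2) t); rewrite lift2_comp /= E1 E2 -surjective_pairing.
Qed.

Lemma lift2J (H : groupType) (h : H) p u : lift2 (jact h p) u = lift2 p u ^ h.
Proof.
elim/free_ind: u => [|[i e] u IHu]; first by rewrite !mult1 conj1g.
rewrite !multM conjMg IHu flet_gen; congr (_ * _).
case: e; rewrite ?multV /= !free_lift_gen /pairf; case: ifP => _ //.
  by rewrite conjVg.
by rewrite conjVg.
Qed.

Lemma generatingJ h p : generating p -> generating (jact h p).
Proof.
move=> gen_p g; have [t tE] := gen_p (g ^ h^-1); exists t.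
by rewrite lift2J tE conjgKV.
Qed.

Lemma generating_sact s e f p : generating p -> generating (sact s e f p).
Proof.
move=> gen_p; apply: (generating_trans gen_p); case: p {gen_p} => u v.
  exists (sgnV e (if s then geny else genx)).
  by case: s e f => [] [] []; rewrite /= ?multV ?lift2x ?lift2y /= ?invgK.
exists (sgnV f (if s then genx else geny)).
by case: s e f => [] [] []; rewrite /= ?multV ?lift2x ?lift2y /= ?invgK.
Qed.

Lemma generating_lract b p : generating p -> generating (lract b p).
Proof.
move=> gen_p; apply: (generating_trans gen_p); case: p {gen_p} => u v.
  exists (if b then genx * geny^-1 else genx).
  by case: b; rewrite ?multM ?multV ?lift2x ?lift2y /= ?mulgK.
exists (if b then geny else genx^-1 * geny).
by case: b; rewrite ?multM ?multV ?lift2x ?lift2y /= ?mulKg.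
Qed.

Lemma generating_lractV b p : generating p -> generating (lractV b p).
Proof.
move=> gen_p; rewrite lractV_sact.
exact/generating_sact/generating_lract/generating_sact.
Qed.

(** * Nielsen reduced pairs *)

Section LetterImages.
Variable p : F2 * F2.

Definition limg (l : letter 'I_2) : F2 := lift2 p (flet l).

Lemma limgV l : limg (linv l) = (limg l)^-1.
Proof.
by case: l => i []; rewrite /limg !flet_gen /= multV ?invgK.
Qed.

Lemma limg_sact l m : l.1 != m.1 ->
  exists s e f, sact s e f p = (limg l, limg m).
Proof.
have lE k : limg k = sgnV k.2 (if k.1 == 0%R then p.1 else p.2).
  by case: k => i []; rewrite /limg flet_gen ?multV /= free_lift_gen.
rewrite !lE; case: l m => i e [j f] /=.
case: i j => [[|[|//]] i_lt] [[|[|//]] j_lt] //= _.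
  by exists false, e, f.
by exists true, f, e.
Qed.

(** The two Gromov products count the letters of the middle image that cancel against its
    neighbours, so the condition says that at least one letter survives. *)
Definition nielsen_reduced : Prop := forall k l m, l != linv k -> m != linv l ->
  (gprod (limg k)^-1 (limg l) + gprod (limg l)^-1 (limg m) < len (limg l))%N.

Lemma nielsen_reduced_len : nielsen_reduced ->
  forall t, (len t <= len (lift2 p t))%N.
Proof.
move=> red; have lneq l : l != linv l :> letter 'I_2 by apply: linv_neq.
(* For the induction, the product is compared with a preceding image: what cancels against the whole
   product is what cancels against its first factor. *)
suff main s l (rs : reduced (l :: s)) k : l != linv k ->
    gprod (limg k)^-1 (lift2 p (FreeGroup rs)) = gprod (limg k)^-1 (limg l) /\
    (gprod (limg k)^-1 (limg l) + size (l :: s) <=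
       len (lift2 p (FreeGroup rs)))%N.
  case=> -[|l s] rs //; have [_] := main s l rs l (lneq l).
  by apply: leq_trans; apply: leq_addl.
elim: s l rs k => [|m s IHs] l rs k lk.
  have -> : FreeGroup rs = flet l by apply: val_inj.
  by split=> //=; have := red k l l lk (lneq l); rewrite -/(limg l); lia.
rewrite free_consE multM -/(limg l).
set Q' := lift2 p _; set Q := limg l * Q'.
have ml : m != linv l by case/andP: (rs).
have [] := IHs m (reduced_behead rs) l ml; rewrite -/Q' => E1 E2.
have red_l := red k l m lk ml.
have := lenM (limg l) Q'; rewrite -/Q E1 => E3.
have := lenVM (limg l) Q; rewrite {1}/Q mulKg => E4.
(* [Q] shares with [limg l] a longer prefix than [(limg k)^-1] does, so [(limg k)^-1] branches off
   from both at the same place. *)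
have := gprod_ultra (limg l) (limg k)^-1 Q.
have := gprod_ultra Q (limg k)^-1 (limg l); rewrite (gprodC Q).
move: E2; rewrite /=; move: (gprod (limg k)^-1 Q) => a.
move: E1 E3 E4 red_l; move: (gprod (limg k)^-1 _) (gprod _ _) (gprod _ _).
by move=> b c d; split; lia.
Qed.

End LetterImages.

Lemma genxy_neq (e : bool) : genx <> sgnV e geny.
Proof. by case: e => /(congr1 (@free_word _)). Qed.

(** As lengths do not decrease, each of [genx] and [geny] is the image of a single letter, and the
    two letters lie over different generators. *)
Lemma nielsen_reduced_standard p :
  generating p -> nielsen_reduced p -> standard p.
Proof.
move=> gen_p /nielsen_reduced_len red.
have letter_pre g : len g = 1%N -> exists l, limg p l = g.
  move=> g1; have [t tE] := gen_p g; have := red t; rewrite tE g1.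
  case: t tE => -[|l [|//]] rt tE _.
    by move: g1; rewrite -tE (_ : FreeGroup rt = 1) ?mult1 //; apply: val_inj.
  by exists l; rewrite -tE; congr (lift2 p _); apply: val_inj.
have [l lx] := letter_pre genx erefl; have [m my] := letter_pre geny erefl.
case: (eqVneq l.1 m.1) => [lm|/(limg_sact p)[s [e [f]]]].
  have [e /genxy_neq //] : exists e, genx = sgnV e geny.
  rewrite -lx -my; case: l m lm {lx my} => i e [j f] /= <-.
  exists (e (+) f); rewrite /limg !flet_gen.
  by case: e f => [] []; rewrite /= ?multV ?invgK.
rewrite lx my => E; have : standard (genx, geny).
  exact: (standard_pos false false false [::]).
rewrite -E => /(standard_sact s (if s then f else e) (if s then e else f)).
by rewrite sactK.
Qed.

(** Otherwise the other entry alone would generate [F2], which would then be commutative. *)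
Lemma generating_neq1 p l : generating p -> limg p l != 1.
Proof.
move=> gen_p; apply/eqP => l1.
have [l' l'neq] : exists l' : letter 'I_2, l.1 != l'.1.
  by case: l {l1} => -[[|[|//]] i] e; [exists (1%R, true) | exists (0%R, true)].
have [s [e [f E]]] := limg_sact p l'neq.
have := generating_sact s e f gen_p; rewrite E l1; set v := limg _ _ => gen_v.
have comm g : (forall h, commute h v -> commute h g).
  have [t <-] := gen_v g; move=> h hv; elim/free_ind: t => [|k u IHu].
    by rewrite mult1; apply: commute1.
  rewrite multM; apply: commuteM => //; case: k => i b.
  rewrite flet_gen; case: b; rewrite ?multV ?[lift2 _ _]free_lift_gen /pairf /=.
    by apply: commuteV; case: ifP => _ //; apply: commute1.
  by case: ifP => _ //; apply: commute1.
have : commute genx geny by apply/comm/commute_sym/comm.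
by move/(congr1 (@free_word _)).
Qed.

(** * Nielsen reduction by induction on the total length *)

Definition plen (p : F2 * F2) : nat := len p.1 + len p.2.

Lemma plen_sact s e f p : plen (sact s e f p) = plen p.
Proof.
have lenS b (g : F2) : len (sgnV b g) = len g by case: b; rewrite /= ?lenV.
by case: p => u v; case: s; rewrite /plen /= !lenS // addnC.
Qed.

Lemma generating_standard p : generating p -> standard p.
Proof.
have [n] := ubnP (plen p); elim: n p => // n IHn p lt_n gen_p.
have std_sact s e f : standard (sact s e f p) -> standard p.
  move/(standard_sact s (if s then f else e) (if s then e else f)).
  by rewrite sactK.
have [[s [e [f]]]|noL] := pselect (exists s e f,
    let q := sact s e f p in (len (q.1 * q.2) < len q.2)%N).
  have := plen_sact s e f p; have := generating_sact s e f gen_p.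
  move: (sact s e f p) (std_sact s e f) => [u v] /= std_q gen_q len_q lt_uv.
  apply: std_q; rewrite (_ : (u, v) = lractV false (lract false (u, v))).
    apply/standard_lractV/IHn; last exact: (generating_lract false gen_q).
    have {}len_q : (len u + len v = plen p)%N by exact: len_q.
    have {}lt_uv : (len (u * v) < len v)%N by exact: lt_uv.
    have lt_n' : (len u + len (u * v) < n)%N by lia.
    exact: lt_n'.
  by rewrite /lractV /= mulKg.
have [[s [e [f [h]]]]|noJ] := pselect (exists s e f h,
    let q := sact s e f p in
    (len (q.1 ^ h) + len ((q.2 * q.1^-1) ^ h) < plen p)%N).
  have := generating_sact s e f gen_p.
  move: (sact s e f p) (std_sact s e f) => [u v] /= std_q gen_q lt_h.
  apply: std_q; have E : jact u (u, v * u^-1) = lractV false (u, v).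
    by rewrite /lractV /jact /=; gnorm.
  have std_h : standard (jact h (u, v * u^-1)).
    apply: IHn; first exact: (leq_trans lt_h lt_n).
    apply: generatingJ; rewrite -[(u, _)]jact1 -(mulgV u) -jactM E.
    exact/generatingJ/generating_lractV.
  have := standard_lract false (standardJ u (standardJV std_h)).
  by rewrite E /lractV /= mulVKg.
(* No move shortens the pair any more. So cancellation between images over different generators
   takes at most half of either one, and an image followed by itself loses less than half. *)
apply: nielsen_reduced_standard => // k l m lk ml.
have w0 i : (0 < len (limg p i))%N.
  by rewrite lt0n; apply: contra (generating_neq1 i gen_p) => /eqP/len_eq0->.
have half i j : i.1 != j.1 ->
    (2 * gprod (limg p i)^-1 (limg p j) <= len (limg p i))%N.
  case/(limg_sact p) => s [e [f E]]; rewrite leqNgt; apply/negP => lt_h.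
  apply: noL; exists s, e, f; rewrite E.
  suff lt_j : (len (limg p i * limg p j) < len (limg p j))%N by exact: lt_j.
  by have := lenM (limg p i) (limg p j); lia.
have halfr i j : i.1 != j.1 ->
    (2 * gprod (limg p i)^-1 (limg p j) <= len (limg p j))%N.
  move=> ij; have := half (linv j) (linv i); rewrite !limgV invgK lenV gprodC.
  by apply; rewrite eq_sym.
have same i : (2 * gprod (limg p i)^-1 (limg p i) < len (limg p i))%N.
  by rewrite gprodC; apply/gprodV_half/generating_neq1.
have same_or_neq (i j : letter 'I_2) : j != linv i -> j = i \/ i.1 != j.1.
  case: i j => i e [j f]; case: (eqVneq i j) => [->|ij _]; last by right.
  by rewrite xpair_eqE eqxx /=; case: e f => [] [] //= _; left.
(* A violation at [l] forces [k] and [m] to lie over the other generator and to cancel exactly half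
   of the image of [l] each. *)
rewrite ltnNge; apply/negP => ge_l.
have [lk' | kl] := same_or_neq _ _ lk.
  subst k; have := same l; have [ml'|lm] := same_or_neq _ _ ml.
    by subst m; lia.
  by have := half _ _ lm; lia.
have k_half := halfr _ _ kl; have k_half' := half _ _ kl.
have [ml'|lm] := same_or_neq _ _ ml; first by subst m; have := same l; lia.
have m_half := half _ _ lm.
have km : m = k \/ m = linv k.
  case: k l m kl lm {lk ml ge_l k_half k_half' m_half}.
  move=> i e [j f] [i' e'] /= ij ji'; have -> : i' = i.
    by case: i i' j ij ji' => [[|[|//]] ?] [[|[|//]] ?] [[|[|//]] ?] //= _ _;
      apply: val_inj.
  by case: e e' => [] []; [left|right|right|left].
set U := limg p l in ge_l k_half m_half *.
(* If [m] is inverse to [k], then [U] and its inverse both share half of their length with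
   [(limg k)^-1], hence with each other, against [gprodV_half]. *)
case: km => [Em|Em]; last first.
  have := gprod_ultra (limg p k)^-1 U U^-1.
  have := gprodV_half (generating_neq1 l gen_p); rewrite -/U.
  move: ge_l k_half m_half; rewrite Em limgV (gprodC U (limg p k)^-1).
  by rewrite (gprodC U^-1 (limg p k)^-1); lia.
rewrite {m ml lm}Em in ge_l m_half *.
(* Both halves of [U] cancel against [V]: if [P] is the first one, then
   [V * U^-1] becomes shorter than [V] by the length of [U] when conjugated by
   [P]. *)
set V := (limg p k)^-1 in ge_l k_half k_half' *.
have VV : limg p k = V^-1 by rewrite invgK.
rewrite VV in ge_l m_half; rewrite VV lenV -/U in k_half'.
have [s [e [f E]]] : exists s e f, sact s e f p = (U, V).
  by rewrite /U /V -limgV; apply: limg_sact; rewrite /= eq_sym.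
have UV : (len U + len V = plen p)%N by rewrite -(plen_sact s e f) E.
have k_le : (gprod V U <= len U)%N by lia.
have [P P_len P_U] := prefix_ex k_le.
apply: noJ; exists s, e, f, P; rewrite E /= -UV.
pose q := U^-1 * P.
have q_len : len q = gprod V U.
  by have := lenVM U P; rewrite (gprodC U P) -/q; lia.
have q_U : gprod q U^-1 = gprod V U.
  have E1 : q^-1 * U^-1 = P^-1 by rewrite /q; gnorm.
  by have := lenVM q U^-1; rewrite E1 (lenV U) (lenV P) q_len P_len; lia.
have P_V : gprod P V = gprod V U.
  have := gprod_ultra U P V; have := gprod_lel P V; rewrite (gprodC U V); lia.
have q_V : gprod q V^-1 = gprod V U.
  have := gprod_ultra U^-1 q V^-1; have := gprod_lel q V^-1; lia.
have VP_len := lenVM V P; rewrite (gprodC V P) P_V P_len in VP_len.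
(* [V^-1 * P] is [V^-1] with its final segment [P^-1] removed. It still begins with [q], because [V]
   is at least twice as long as [P]. *)
have VP_V : gprod (V^-1 * P) V^-1 = (len V - gprod V U)%N.
  have E1 : (V^-1 * P)^-1 * V^-1 = P^-1 by gnorm.
  by have := lenVM (V^-1 * P) V^-1; rewrite E1 (lenV V) (lenV P) P_len; lia.
have VP_q : gprod (V^-1 * P) q = gprod V U.
  have := gprod_ultra V^-1 (V^-1 * P) q; have := gprod_lel q (V^-1 * P).
  rewrite (gprodC V^-1 q) (gprodC q (V^-1 * P)); lia.
have E1 : U ^ P = q^-1 * P by rewrite /q; gnorm.
have E2 : (V * U^-1) ^ P = (V^-1 * P)^-1 * q by rewrite /q; gnorm.
suff lt_p : (len (q^-1 * P) + len ((V^-1 * P)^-1 * q) < len U + len V)%N.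
  by rewrite E1 E2.
have := lenVM (V^-1 * P) q; rewrite VP_q.
have := lenVM q P; have := w0 l; rewrite -/U; lia.
Qed.

(** * Exponent sums *)

Section ExpSum.
Variables (I : choiceType) (i : I).
Local Open Scope ring_scope.

Lemma expsumM (u v : free_group I) :
  expsum i (u * v)%g = expsum i u + expsum i v.
Proof.
pose F (l : letter I) : int := if l.1 == i then (-1) ^+ l.2 else 0.
have FV l : F (linv l) = - F l.
  rewrite /F /=; case: ifP => _; rewrite ?oppr0 //.
  by case: l.2; rewrite ?opprK.
have consE l r : \sum_(k <- cons_red l r) F k = F l + \sum_(k <- r) F k.
  case: r => [|m r]; rewrite /= ?big_seq1 ?big_nil ?addr0 //.
  by case: eqP => [->|_]; rewrite !big_cons // FV addNKr.
rewrite /expsum !(big_mkcond (fun l => l.1 == i)) -!/(F _).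
case: u v => [s rs] [t rt] /=.
elim: s {rs} => [|l s IHs] /=; first by rewrite big_nil add0r.
by rewrite consE IHs big_cons addrA.
Qed.

Lemma expsum1 : expsum i 1%g = 0.
Proof. by rewrite /expsum big_nil. Qed.

Lemma expsumV (u : free_group I) : expsum i u^-1%g = - expsum i u.
Proof. by apply/eqP; rewrite -addr_eq0 -expsumM mulVg expsum1. Qed.

Lemma expsumJ (u v : free_group I) : expsum i (u ^ v)%g = expsum i u.
Proof. by rewrite !expsumM expsumV addrC addrK. Qed.

Lemma expsumX (u : free_group I) n : expsum i (u ^+ n)%g = expsum i u *+ n.
Proof. by elim: n => [|n IHn]; rewrite ?expsum1 // expgS expsumM IHn mulrS. Qed.

Lemma expsum_gen j : expsum i (gen j) = (j == i)%:R.
Proof. by rewrite /expsum big_mkcond big_seq1 /=; case: eqP. Qed.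

End ExpSum.

(** * Nielsen's theorem on automorphisms trivial on the abelianization *)

Section Standard.
Local Open Scope ring_scope.

Definition ex (g : F2) : int := expsum 0 g.
Definition ey (g : F2) : int := expsum 1 g.

Lemma exyE : (ex genx = 1) * (ex geny = 0) * (ey genx = 0) * (ey geny = 1).
Proof. by rewrite /ex /ey !expsum_gen. Qed.

Definition sgn (b : bool) : int := if b then -1 else 1.

(** A nonempty sequence of positive moves leaves an entry with two positive coordinates, whereas a
    signed permutation of the standard basis has none. Hence no move occurs, and only signed
    permutations and a conjugation remain. *)
Lemma standard_ab1 p : standard p ->
  ex p.1 = 1 -> ey p.1 = 0 -> ex p.2 = 0 -> ey p.2 = 1 ->
  exists h, p = jact h (genx, geny).
Proof.
have exV g : ex g^-1%g = - ex g by apply: expsumV.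
have eyV g : ey g^-1%g = - ey g by apply: expsumV.
case=> s [e [f [P [s' [e' [f' [h ->]]]]]]].
rewrite {1 2 3 4}/jact /ex /ey !expsumJ -!/(ex _) -!/(ey _).
(* The coordinates in the basis given by the two letters of which the basis
   [foldr ...] consists of positive words *)
pose al g := if s then sgn f * ey g else sgn e * ex g.
pose be g := if s then sgn e * ex g else sgn f * ey g.
have alM g k : al (g * k)%g = al g + al k.
  by rewrite /al /ex /ey !expsumM; case: ifP => _; rewrite mulrDr.
have beM g k : be (g * k)%g = be g + be k.
  by rewrite /be /ex /ey !expsumM; case: ifP => _; rewrite mulrDr.
have [exx eyx exy eyy] :
    [/\ ex genx = 1, ex geny = 0, ey genx = 0 & ey geny = 1].
  by rewrite !exyE.
set q := foldr _ _ P; move=> q1x q1y q2x q2y.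
have abq (b : bool) : let g := if b then q.1 else q.2 in al g * be g = 0.
  suff : ex (if b then q.1 else q.2) * ey (if b then q.1 else q.2) = 0.
    move=> /= E0; rewrite /al /be; case: ifP => _.
      by rewrite mulrACA [ey _ * _]mulrC E0 mulr0.
    by rewrite mulrACA E0 mulr0.
  move: q1x q1y q2x q2y; case: q => u v; case: b s' e' f' => [] [] [] [];
    rewrite /sact /= ?exV ?eyV; lia.
have P_inv : [/\ 1 <= al q.1, 0 <= be q.1, 0 <= al q.2, 1 <= be q.2 &
    P != [::] -> 1 <= be q.1 \/ 1 <= al q.2].
  rewrite /q; elim: P {q q1x q1y q2x q2y abq} => [|c P] /=.
    rewrite /al /be; case: s e f {al be alM beM} => [] [] [];
      by rewrite /sact /= ?exV ?eyV exx eyx exy eyy; split.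
  move: (foldr _ _ P) => [u v] /= [? ? ? ? _].
  by case: c; rewrite /= ?alM ?beM; split; lia.
have P0 : P = [::].
  case: P_inv => i1 i2 i3 i4 i5.
  apply: contrapT => /eqP/i5; move: i1 i2 i3 i4 (abq false) (abq true) => /=.
  by move: (al _) (be _) (al _) (be _) => a1 b1 a2 b2; nia.
exists h; congr (jact h _); move: q1x q1y q2x q2y; rewrite /q P0 /=.
by case: s e f s' e' f' {al be alM beM q abq P_inv} => [] [] [] [] [] [];
  rewrite /sact /= ?invgK ?exV ?eyV ?exx ?eyx ?exy ?eyy.
Qed.

End Standard.

Section AbMx.
Local Open Scope ring_scope.
Implicit Types s t : {multiplicative F2 -> F2}.

Lemma ord2P (i : 'I_2) : i = 0 \/ i = 1.
Proof. by case: i => [[|[|//]] i_lt]; [left|right]; apply: val_inj. Qed.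

Lemma expsum_mult s i u :
  expsum i (s u) = ab_mx s i 0 * expsum 0 u + ab_mx s i 1 * expsum 1 u.
Proof.
rewrite !mxE; elim/free_ind: u => [|l u IHu].
  by rewrite mult1 !expsum1 !mulr0 addr0.
rewrite multM !expsumM IHu.
suff -> : expsum i (s (flet l)) = expsum i (s (gen 0)) * expsum 0 (flet l)
    + expsum i (s (gen 1)) * expsum 1 (flet l) by ring.
case: l => j [] /=; rewrite flet_gen ?multV ?expsumV !expsum_gen.
  by have [-> | ->] := ord2P j; rewrite /=; ring.
by have [-> | ->] := ord2P j; rewrite /=; ring.
Qed.

Lemma ab_mxM s t (st : {multiplicative F2 -> F2}) : st =1 s \o t ->
  ab_mx st = ab_mx s *m ab_mx t.
Proof.
move=> stE; apply/matrixP => i j.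
rewrite !mxE stE /= expsum_mult big_ord_recl big_ord1 !mxE.
by rewrite (_ : lift ord0 ord0 = 1) //; apply: val_inj.
Qed.

(** The images of the generators form a generating pair, hence a standard one, and [standard_ab1]
    provides the conjugating element. *)
Lemma ab_mx1_inner s : bijective s -> ab_mx s = 1%:M ->
  exists h, forall u, s u = (u ^ h)%g.
Proof.
case=> s' _ sK ab1.
have gen_s : generating (s genx, s geny).
  move=> g; exists (s' g); rewrite -[RHS]sK.
  by apply: eq_mult; rewrite ?lift2x ?lift2y.
have abE i j : expsum i (s (gen j)) = (i == j)%:R.
  by have := congr1 (fun M : 'M_2 => M i j) ab1; rewrite !mxE.
have := standard_ab1 (generating_standard gen_s); rewrite /ex /ey /= !abE.
case=> // h E; exists h => u.
transitivity (lift2 (jact h (genx, geny)) u).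
  by apply: eq_mult; rewrite -E ?lift2x ?lift2y.
rewrite lift2J; congr (_ ^ h)%g.
by apply: eq_mult_id; rewrite ?lift2x ?lift2y.
Qed.

End AbMx.

(** * Subgroups and cosets *)

Section SubgroupTheory.
Variables (G : groupType) (H : set G).
Hypothesis sgH : subgroup H.

Lemma subgroup1 : H 1. Proof. by case: sgH. Qed.
Lemma subgroupV g : H g -> H g^-1.
Proof. by case: sgH => H1 HF Hg; rewrite -[g^-1]mul1g; apply: HF. Qed.
Lemma subgroupM g h : H g -> H h -> H (g * h).
Proof. by case: sgH => _ HF Hg /subgroupV Hh; rewrite -[h]invgK; apply: HF. Qed.

Lemma eq_left_coset g h : H (g^-1 * h) -> left_coset g H = left_coset h H.
Proof.
move=> Hgh; apply/seteqP; split=> _ [k Hk <-].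
  exists (h^-1 * g * k); last by gnorm.
  apply: subgroupM => //; rewrite -[h^-1 * g]invgK; apply: subgroupV.
  by rewrite invMg invgK.
by exists (g^-1 * h * k); [apply: subgroupM | gnorm].
Qed.

End SubgroupTheory.

(** * Elementary matrices *)

Section SL2Elements.
Local Open Scope ring_scope.
Variable R : comPzRingType.

Definition mx2 (a b c d : R) : 'M[R]_2 :=
  \matrix_(i, j) if i == 0 then if j == 0 then a else b
                 else if j == 0 then c else d.

Lemma det2 (A : 'M[R]_2) : \det A = A 0 0 * A 1 1 - A 0 1 * A 1 0.
Proof.
have E (i : 'I_1) : lift 0 i = 1 :> 'I_2 by apply: val_inj; case: i => -[].
have F (i : 'I_1) : lift 1 i = 0 :> 'I_2 by apply: val_inj; case: i => -[].
rewrite (expand_det_row _ 0) big_ord_recl big_ord1 E /cofactor !det_mx11 !mxE.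
by rewrite E F expr0 expr1; ring.
Qed.

Fact sl2_subproof a b c d : a * d - b * c = 1 -> \det (mx2 a b c d) == 1.
Proof. by move=> abcd; rewrite det2 !mxE abcd. Qed.

Definition sl2 a b c d (abcd : a * d - b * c = 1) : SL2 R :=
  MkSL2 (sl2_subproof abcd).

Lemma sl_eqP (A B : SL2 R) : A 0 0 = B 0 0 -> A 0 1 = B 0 1 ->
  A 1 0 = B 1 0 -> A 1 1 = B 1 1 -> A = B.
Proof.
move=> E00 E01 E10 E11; apply/val_inj/matrixP => i j.
by have [->|->] := ord2P i; have [->|->] := ord2P j.
Qed.

Lemma slME (A B : SL2 R) i j : (A * B)%g i j = A i 0 * B 0 j + A i 1 * B 1 j.
Proof.
rewrite mxE big_ord_recl big_ord1; congr (_ + A i _ * B _ j); exact: val_inj.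
Qed.

Lemma sl1E i j : (1%g : SL2 R) i j = (i == j)%:R.
Proof. by rewrite mxE. Qed.

Lemma slE (A : SL2 R) : A 0 0 * A 1 1 - A 0 1 * A 1 0 = 1.
Proof. by rewrite -det2; apply/eqP/slmxP. Qed.

Fact E12_subproof r : 1 * 1 - r * 0 = 1 :> R. Proof. by ring. Qed.
Fact E21_subproof r : 1 * 1 - 0 * r = 1 :> R. Proof. by ring. Qed.
Fact E11_subproof r : (1 + r) * (1 - r) - (- r) * r = 1 :> R.
Proof. by ring. Qed.
Definition E12 r := sl2 (E12_subproof r).
Definition E21 r := sl2 (E21_subproof r).
(* The transvection fixing (1, 1) *)
Definition E11 r := sl2 (E11_subproof r).

Arguments E12 r%_R.
Arguments E21 r%_R.
Arguments E11 r%_R.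

Ltac slring := apply: sl_eqP; rewrite ?slME ?sl1E /= ?mxE /=; ring.

Lemma E12D r s : E12 (r + s) = (E12 r * E12 s)%g. Proof. slring. Qed.
Lemma E21D r s : E21 (r + s) = (E21 r * E21 s)%g. Proof. slring. Qed.
Lemma E11D r s : E11 (r + s) = (E11 r * E11 s)%g. Proof. slring. Qed.
Lemma E12_0 : E12 0 = 1%g. Proof. slring. Qed.
Lemma E21_0 : E21 0 = 1%g. Proof. slring. Qed.
Lemma E11_0 : E11 0 = 1%g. Proof. slring. Qed.

Lemma subgroup_mulz (H : set (SL2 R)) (E : R -> SL2 R) : subgroup H ->
  E 0 = 1%g -> (forall r s, E (r + s) = (E r * E s)%g) ->
  forall r (z : int), H (E r) -> H (E (r *~ z)).
Proof.
move=> sgH E0 ED r z Hr.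
have EX n : H (E (r *+ n)).
  elim: n => [|n IHn]; first by rewrite mulr0n E0; apply: subgroup1.
  by rewrite mulrS ED; apply: subgroupM.
case: z => n; first exact: EX.
have EN q : E (- q) = (E q)^-1%g by apply/esym/mulg1_eq; rewrite -ED subrr.
by rewrite -[r *~ _]/(- (r *+ n.+1)) EN; apply: subgroupV.
Qed.

(* [E21 (- e)] maps (1, 1) to (1, 1 - e), which is (1, 0) where [e] is 1, and
   these transvections are trivial where [e] is 0. *)
Lemma E12_E11 e : e * e = e -> E12 e = (E21 (- e) * E11 (- e) * E21 e)%g.
Proof.
move=> ee; have e3 : e * e * e = e by rewrite !ee.
by apply: sl_eqP; rewrite ?slME /= ?mxE /=; ring: ee e3.
Qed.

Lemma E21_E11 e : e * e = e -> E21 e = (E12 (- e) * E11 e * E12 e)%g.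
Proof.
move=> ee; have e3 : e * e * e = e by rewrite !ee.
by apply: sl_eqP; rewrite ?slME /= ?mxE /=; ring: ee e3.
Qed.

Fact diag_subproof u v : u * v = 1 -> u * v - 0 * 0 = 1 :> R.
Proof. by move=> ->; ring. Qed.

(* Whitehead's identity *)
Lemma diag_elementary (u v : R) (uv : u * v = 1) :
  sl2 (diag_subproof uv) =
  (E12 u * E21 (- v) * E12 u * E12 (-1) * E21 1 * E12 (-1))%g.
Proof.
by apply: sl_eqP; rewrite ?slME /= ?mxE /=; ring: uv.
Qed.

(** Euclid's algorithm on integer lifts of the bottom row. Asking only that integers map onto [R]
    covers both the integers and [zmod n]. *)
Lemma elementary_generate (H : set (SL2 R)) :
  (forall r : R, exists z : int, r = z%:~R) ->
  subgroup H -> H (E12 1) -> H (E21 1) -> forall A, H A.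
Proof.
move=> Rz sgH H12 H21.
have E12H r : H (E12 r).
  by have [z ->] := Rz r; apply: (subgroup_mulz sgH E12_0 E12D).
have E21H r : H (E21 r).
  by have [z ->] := Rz r; apply: (subgroup_mulz sgH E21_0 E21D).
have HMl B A : H B -> H (A * B)%g -> H A.
  move=> HB HAB; rewrite -[A](mulgK B).
  by apply: subgroupM => //; apply: subgroupV.
move=> A; have [c Ac] := Rz (A 1 0); have [d Ad] := Rz (A 1 1).
have [n] := ubnP `|c|%N; elim: n c d A Ac Ad => // n IHn c d A Ac Ad.
rewrite ltnS => lt_n.
have [c0 | c_neq0] := eqVneq c 0.
  have ad : A 0 0 * A 1 1 = 1 by rewrite -(slE A) Ac c0 mulr0z mulr0 subr0.
  have -> : A = (sl2 (diag_subproof ad) * E12 (A 1 1 * A 0 1)%R)%g.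
    by apply: sl_eqP; rewrite ?slME /= ?mxE /= ?Ac ?c0; ring: ad.
  by rewrite diag_elementary; do ![apply: subgroupM].
(* Right multiplication by [S] turns a bottom row (c, d) into (d, -c); after the division step, the
   new lower left entry is the remainder. *)
pose S := (E12 (-1) * E21 1 * E12 (-1))%g.
have HS : H S by do ![apply: subgroupM].
apply: (HMl (E12 (- (d %/ c)%Z%:~R) * S)%g); first exact: subgroupM.
apply: (IHn (d %% c)%Z (- c)).
- have dE : d%:~R = (d %/ c)%Z%:~R * c%:~R + (d %% c)%Z%:~R :> R.
    by rewrite -rmorphM -rmorphD -divz_eq.
  rewrite ?slME /= ?mxE /= Ac Ad.
  by rewrite dE; set x := c%:~R; set y := (d %/ c)%Z%:~R; set z := _%:~R; ring.
- by rewrite ?slME /= ?mxE /= Ac Ad rmorphN /=; ring.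
- by have := modz_ge0 d c_neq0; have := ltz_mod d c_neq0; lia.
Qed.

End SL2Elements.

Arguments E12 {R} r%_R.
Arguments E21 {R} r%_R.
Arguments E11 {R} r%_R.

(** * Generation of SL_2(Z/n) by unipotents with coprime parameters *)

Section Zmod.
Local Open Scope ring_scope.
Variable n : nat.
Hypothesis n_gt0 : (0 < n)%N.

Lemma zmod_natE k : k%:R = inZp k :> zmod n.
Proof.
elim: k => [|k IHk]; first exact: val_inj.
by rewrite mulrS IHk; apply: val_inj; rewrite /= modnDmr modnDml.
Qed.

Lemma zmod_eq_nat a b : a = b %[mod n] -> a%:R = b%:R :> zmod n.
Proof.
by move=> ab; rewrite !zmod_natE; apply: val_inj; rewrite /= prednK.
Qed.

Lemma zmod_intE (r : zmod n) : exists z : int, r = z%:~R.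
Proof.
exists (val r)%:Z; rewrite -pmulrn zmod_natE; apply/val_inj.
by rewrite /= modn_small.
Qed.

(* [e] is 1 modulo the part of [n] prime to [a], and 0 modulo the other part. *)
Lemma zmod_idempotent a b c : (0 < a)%N -> (0 < b)%N -> (0 < c)%N ->
  coprime a b -> coprime a c ->
  exists e : zmod n, e * e = e /\ exists x y z : nat,
    [/\ e = a%:R *+ x, 1 - e = b%:R *+ y & 1 - e = c%:R *+ z].
Proof.
move=> a_gt0 b_gt0 c_gt0 ab ac.
pose n1 := (n`_(\pi(a)^'))%N; pose n2 := (n`_(\pi(a)))%N.
have nE : n = (n1 * n2)%N by rewrite mulnC partnC.
have n1_gt0 : (0 < n1)%N by apply: part_gt0.
have n1a : coprime n1 a.
  by rewrite coprime_sym (coprime_pi' _ _) //; apply: part_pnat.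
have n12 : coprime n1 n2 by rewrite coprime_sym coprime_partC.
have n2co d : (0 < d)%N -> coprime a d -> coprime d n2.
  move=> d_gt0 ad; rewrite coprime_sym; apply: (pnat_coprime (part_pnat _ _)).
  by rewrite -coprime_pi'.
(* The modulus [n2 * a] in place of [n2] makes the representative itself divisible by [a]; [f] below
   is made divisible by [d] in the same way. *)
pose e0 := chinese n1 (n2 * a) 1 0.
have co_e : coprime n1 (n2 * a) by rewrite coprimeMr n12.
have e01 : (e0 = 1 %[mod n1])%N by apply: chinese_modl.
have e0a : (n2 * a %| e0)%N by rewrite /dvdn chinese_modr // mod0n.
have e02 : (e0 %% n2 = 0)%N.
  by apply/eqP; apply: dvdn_trans (dvdn_mulr a (dvdnn n2)) e0a.
have eq_mod u v : (u = v %[mod n1])%N -> (u = v %[mod n2])%N ->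
    u%:R = v%:R :> zmod n.
  move=> /eqP u1 /eqP u2; apply: zmod_eq_nat; apply/eqP.
  by rewrite nE chinese_remainder // u1.
have fP d : (0 < d)%N -> coprime a d ->
    exists x, 1 - e0%:R = d%:R *+ x :> zmod n.
  move=> d_gt0 ad; pose f := chinese (n1 * d) n2 0 1.
  have co_d : coprime (n1 * d) n2 by rewrite coprimeMl n12 n2co.
  have fd : (n1 * d %| f)%N by rewrite /dvdn chinese_modl // mod0n.
  have f2 : (f = 1 %[mod n2])%N by apply: chinese_modr.
  have f1 : (f %% n1 = 0)%N.
    by apply/eqP; apply: dvdn_trans (dvdn_mulr d (dvdnn n1)) fd.
  exists (f %/ d)%N; rewrite -mulrnA mulnC divnK; last first.
    exact: dvdn_trans (dvdn_mull n1 (dvdnn d)) fd.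
  apply/eqP; rewrite subr_eq -natrD eq_sym; apply/eqP/(eq_mod _ 1%N).
    by rewrite -modnDm f1 e01 add0n modn_mod.
  by rewrite -modnDm f2 e02 addn0 modn_mod.
exists e0%:R; split.
  rewrite -natrM; apply: eq_mod; first by rewrite -modnMm e01 modnMm.
  by rewrite -modnMm e02 mod0n.
have [y yE] := fP b b_gt0 ab; have [z zE] := fP c c_gt0 ac.
exists (e0 %/ a)%N, y, z; split=> //.
rewrite -mulrnA mulnC divnK //.
exact: dvdn_trans (dvdn_mull n2 (dvdnn a)) e0a.
Qed.

(** Write 1 as [e + (1 - e)] with [e] a multiple of [a], and [1 - e] an idempotent multiple of both
    [b] and [c]. The first summand comes from [E12 a%:R], the second from the other two unipotents
    by [E12_E11]. The same with [a] and [b] exchanged gives [E21 1]. *)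
Lemma unipotents_generate (a b c : nat) (H : set (SL2 (zmod n))) :
  (0 < a)%N -> (0 < b)%N -> (0 < c)%N ->
  coprime a b -> coprime a c -> coprime b c -> subgroup H ->
  H (E12 a%:R) -> H (E21 b%:R) -> H (E11 c%:R) -> forall A, H A.
Proof.
move=> a_gt0 b_gt0 c_gt0 ab ac bc sgH Ha Hb Hc.
have E12H r (z : int) : H (E12 r) -> H (E12 (r *~ z)).
  exact: (subgroup_mulz sgH (E12_0 _) (@E12D _)).
have E21H r (z : int) : H (E21 r) -> H (E21 (r *~ z)).
  exact: (subgroup_mulz sgH (E21_0 _) (@E21D _)).
have E11H r (z : int) : H (E11 r) -> H (E11 (r *~ z)).
  exact: (subgroup_mulz sgH (E11_0 _) (@E11D _)).
have idem_subr (R : comPzRingType) (e : R) :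
    e * e = e -> (1 - e) * (1 - e) = 1 - e.
  by move=> ee; ring: ee.
apply: (elementary_generate zmod_intE sgH).
  have [e [ee [x [y [z [Ex Ey Ez]]]]]] :=
    zmod_idempotent a_gt0 b_gt0 c_gt0 ab ac.
  rewrite -(subrKC e 1) E12D (E12_E11 (idem_subr _ e ee)).
  apply: subgroupM => //.
    by rewrite Ex pmulrn; apply: E12H.
  do ![apply: subgroupM => //].
  - by rewrite Ey pmulrn -mulrNz; apply: E21H.
  - by rewrite Ez pmulrn -mulrNz; apply: E11H.
  - by rewrite Ey pmulrn; apply: E21H.
rewrite coprime_sym in ab.
have [e [ee [x [y [z [Ex Ey Ez]]]]]] :=
  zmod_idempotent b_gt0 a_gt0 c_gt0 ab bc.
rewrite -(subrKC e 1) E21D (E21_E11 (idem_subr _ e ee)).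
apply: subgroupM => //.
  by rewrite Ex pmulrn; apply: E21H.
do ![apply: subgroupM => //].
- by rewrite Ey pmulrn -mulrNz; apply: E12H.
- by rewrite Ez pmulrn; apply: E11H.
- by rewrite Ey pmulrn; apply: E12H.
Qed.

End Zmod.

(** * Reduction modulo n *)

Section Reduction.
Variable n : nat.
Local Open Scope ring_scope.

Lemma sl_redE (A : SL2Z) i j : sl_red n A i j = (A i j)%:~R.
Proof. by rewrite !mxE. Qed.

Lemma sl_redM (A B : SL2Z) : sl_red n (A * B)%g = (sl_red n A * sl_red n B)%g.
Proof. by apply: sl_eqP; rewrite sl_redE !slME !sl_redE rmorphD !rmorphM. Qed.

Lemma sl_red1 : sl_red n 1%g = 1%g.
Proof. by apply: (mulgI (sl_red n 1%g)); rewrite -sl_redM !mulg1. Qed.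

Lemma sl_redV (A : SL2Z) : sl_red n A^-1%g = (sl_red n A)^-1%g.
Proof. by apply/esym/mulg1_eq; rewrite -sl_redM mulgV sl_red1. Qed.

Lemma sl_red_E12 k : sl_red n (E12 k%:R) = E12 k%:R.
Proof. by apply: sl_eqP; rewrite sl_redE !mxE /= ?rmorph_nat. Qed.

Lemma sl_red_E21 k : sl_red n (E21 k%:R) = E21 k%:R.
Proof. by apply: sl_eqP; rewrite sl_redE !mxE /= ?rmorph_nat. Qed.

Lemma sl_red_E11 k : sl_red n (E11 k%:R) = E11 k%:R.
Proof.
by apply: sl_eqP; rewrite sl_redE !mxE /= ?rmorphD ?rmorphN ?rmorph_nat.
Qed.

Lemma subgroup_red (Gamma : set SL2Z) : subgroup Gamma ->
  subgroup [set A | exists2 g, Gamma g & sl_red n g = A].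
Proof.
move=> sgG; split; first by exists 1%g; [apply: subgroup1 | apply: sl_red1].
move=> _ _ [g Gg <-] [h Gh <-]; exists (g * h^-1)%g.
  by case: sgG => _; apply.
by rewrite sl_redM sl_redV.
Qed.

End Reduction.

(** * Automorphisms of [F2] and the stabilizer *)

Section Lifts.
Implicit Types s t : {multiplicative F2 -> F2}.

(** The inverse function carries no morphism structure, so it is rebuilt as a lift. *)
Lemma inverse_mult s : bijective s ->
  exists t,
    [/\ bijective t, cancel s t, cancel t s & ab_mx t *m ab_mx s = 1%:M]%R.
Proof.
case=> s' sK s'K; exists (lift2 (s' genx, s' geny)).
have tK : cancel (lift2 (s' genx, s' geny)) s.
  apply: (@eq_mult_id (s \o lift2 (s' genx, s' geny))).
    by rewrite /= lift2x s'K.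
  by rewrite /= lift2y s'K.
have Kt : cancel s (lift2 (s' genx, s' geny)).
  by move=> u; apply: (can_inj sK); rewrite tK.
split=> //; first by exists s.
rewrite -(@ab_mxM _ _ idfun) => [|u /=]; last by rewrite Kt.
by apply/matrixP => i j; rewrite !mxE expsum_gen eq_sym.
Qed.

Lemma bij_lift2 (p q : F2 * F2) :
  lift2 p q.1 = genx -> lift2 p q.2 = geny ->
  lift2 q p.1 = genx -> lift2 q p.2 = geny -> bijective (lift2 p).
Proof.
move=> pq1 pq2 qp1 qp2; exists (lift2 q) => u.
  by apply: (@eq_mult_id (lift2 q \o lift2 p)); rewrite /= ?lift2x ?lift2y.
by apply: (@eq_mult_id (lift2 p \o lift2 q)); rewrite /= ?lift2x ?lift2y.
Qed.

Variables (G : groupType) (phi : {multiplicative F2 -> G}).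

Lemma stab_classP (g : SL2Z) : stab_class phi g <->
  exists s k, [/\ bijective s, ab_mx s = g & forall u, phi (s u) = phi u ^ k].
Proof.
split=> [[s [bs sg E]] | [s [k [bs sg E]]]].
  have : inn_class (phi \o s) (phi \o s) by exists 1 => u; rewrite conjg1.
  by rewrite E => -[k kE]; exists s, k.
exists s; split=> //; apply/seteqP; split=> psi [h hE].
  by exists (k * h) => u; rewrite hE /= E conjgM.
by exists (k^-1 * h) => u; rewrite hE /= E -conjgM mulKVg.
Qed.

Lemma subgroup_stab_class : subgroup (stab_class phi).
Proof.
split.
  apply/stab_classP; exists (idfun : {multiplicative F2 -> F2}), 1; split.
  - by exists id.
  - by apply/matrixP => i j; rewrite !mxE expsum_gen eq_sym.
  - by move=> u; rewrite conjg1.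
move=> g h /stab_classP[s [k [bs sg sE]]] /stab_classP[t [l [bt th tE]]].
have [t' [bt' tK t'K ab_t']] := inverse_mult bt.
apply/stab_classP; exists (s \o t' : {multiplicative F2 -> F2}), (l^-1 * k).
split.
- exact: bij_comp.
- rewrite (@ab_mxM s t') //= sg; congr (_ *m _)%R.
  have hV : (slmx h *m slmx (h^-1)%g = 1%:M)%R.
    by rewrite -[LHS]/(slmx (h * h^-1)) mulgV.
  by rewrite -[LHS]mulmx1 -hV mulmxA -{1}th ab_t' mul1mx.
- move=> u; have -> : phi u = phi (t' u) ^ l by rewrite -tE t'K.
  by rewrite conjgM conjgK sE.
Qed.

Lemma stab_class_lift2 (p q : F2 * F2) (g : SL2Z) :
  lift2 p q.1 = genx -> lift2 p q.2 = geny ->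
  lift2 q p.1 = genx -> lift2 q p.2 = geny ->
  phi p.1 = phi genx -> phi p.2 = phi geny ->
  ab_mx (lift2 p) = g -> stab_class phi g.
Proof.
move=> pq1 pq2 qp1 qp2 p1 p2 pg; apply/stab_classP.
exists (lift2 p), 1; split=> //.
  exact: bij_lift2 pq1 pq2 qp1 qp2.
move=> u; rewrite conjg1; apply: (@eq_mult _ (phi \o lift2 p)) => /=.
  by rewrite lift2x.
by rewrite lift2y.
Qed.

(** The lift fixes [genx] and multiplies [geny] by [genx ^+ n], which [phi] kills; so [phi] itself
    is preserved, not only its class. *)
Lemma stab_class_E12 n : phi genx ^+ n = 1 -> stab_class phi (E12 n%:R%R).
Proof.
move=> xn.
apply: (@stab_class_lift2 (genx, genx ^+ n * geny) (genx, genx ^- n * geny));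
  rewrite /= ?multM ?multV ?multX ?lift2x ?lift2y /=
    ?xn ?mul1g ?mulKg ?mulVKg //.
apply/matrixP => i j; rewrite !mxE.
have [->|->] := ord2P j; rewrite -/genx -/geny ?lift2x ?lift2y /=;
  have [->|->] := ord2P i; rewrite ?expsumM ?expsumX ?expsum_gen /=; ring.
Qed.

Lemma stab_class_E21 n : phi geny ^+ n = 1 -> stab_class phi (E21 n%:R%R).
Proof.
move=> yn.
apply: (@stab_class_lift2 (genx * geny ^+ n, geny) (genx * geny ^- n, geny));
  rewrite /= ?multM ?multV ?multX ?lift2x ?lift2y /=
    ?yn ?mulg1 ?mulgK ?mulgVK //.
apply/matrixP => i j; rewrite !mxE.
have [->|->] := ord2P j; rewrite -/genx -/geny ?lift2x ?lift2y /=;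
  have [->|->] := ord2P i; rewrite ?expsumM ?expsumX ?expsum_gen /=; ring.
Qed.

Lemma stab_class_E11 n :
  phi (genx * geny) ^+ n = 1 -> stab_class phi (E11 n%:R%R).
Proof.
(* [w] is fixed by the transvection, and is kept opaque so that its powers are not expanded. *)
have [w wdef] : exists w, w = genx * geny by exists (genx * geny).
rewrite -wdef => wn.
have wL p : lift2 p w = p.1 * p.2 by rewrite wdef multM lift2x lift2y.
have w1 : genx * w ^+ n * (w ^- n * geny) = w by rewrite mulgA mulgK.
have w2 : genx * w ^- n * (w ^+ n * geny) = w by rewrite mulgA mulgVK.
apply: (@stab_class_lift2 (genx * w ^+ n, w ^- n * geny)
                          (genx * w ^- n, w ^+ n * geny));
  rewrite ?multM ?multV ?multX ?lift2x ?lift2y ?wL /= ?w1 ?w2 ?wn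
    ?invg1 ?mulg1 ?mul1g ?mulgK ?mulgVK ?mulKg ?mulVKg //.
apply/matrixP => i j; rewrite !mxE.
have [->|->] := ord2P j; rewrite -/genx -/geny ?lift2x ?lift2y /=;
  have [->|->] := ord2P i;
  rewrite ?wdef ?(expsumM, expsumV, expsumX, expsum_gen) /=; ring.
Qed.

End Lifts.

(** The matrices that lift form the stabilizer of the trivial morphism, a subgroup which contains
    both elementary generators. *)
Lemma lift_exists (g : SL2Z) : exists s : {multiplicative F2 -> F2},
  bijective s /\ ab_mx s = g.
Proof.
pose phi : {multiplicative F2 -> F2} := lift2 (1, 1).
suff /stab_classP[s [_ [bs sg _]]] : stab_class phi g by exists s.
apply: (elementary_generate (H := stab_class phi)).
- by move=> z; exists z; rewrite intz.
- exact: subgroup_stab_class.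
- by apply: (@stab_class_E12 _ phi 1); rewrite lift2x.
- by apply: (@stab_class_E21 _ phi 1); rewrite lift2y.
Qed.

Lemma finite_index_stab_class (gT : finGroupType)
    (phi : {multiplicative F2 -> gT}) :
  finite_index_subgroup (stab_class phi).
Proof.
split; first exact: subgroup_stab_class.
(* The coset of [g] is determined by [phi \o s] for any lift [s] of [g^-1]. *)
pose rel (g : SL2Z) (p : gT * gT) := exists s : {multiplicative F2 -> F2},
  [/\ bijective s, ab_mx s = slmx (g^-1)%g & (phi (s genx), phi (s geny)) = p].
(* A pair related to no matrix gets the default coset of 1, which is harmless: the finite family
   only has to cover all cosets. *)
pose coset p := left_coset (xget 1 [set g | rel g p]%classic) (stab_class phi).
apply: (@sub_finite_set _ _ (coset @` [set: gT * gT])%classic); last first.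
  exact/finite_image/finite_finset.
move=> _ [g _ <-]; have [s [bs sg]] := lift_exists g^-1.
exists (phi (s genx), phi (s geny)) => //; rewrite /coset.
case: xgetP => [h _ [t [bt th [Ex Ey]]] | /(_ g)[]]; last by exists s.
have [s' [bs' sK s'K ab_s']] := inverse_mult bs.
apply: (eq_left_coset (subgroup_stab_class phi)); apply/stab_classP.
exists (t \o s' : {multiplicative F2 -> F2}), 1; split.
- exact: bij_comp.
- rewrite (@ab_mxM t s') // th; congr (_ *m _)%R.
  have gV : (slmx (g^-1)%g *m slmx g = 1%:M)%R.
    by rewrite -[LHS]/(slmx (g^-1 * g)) mulVg.
  by rewrite -[LHS]mulmx1 -gV mulmxA -{1}sg ab_s' mul1mx.
move=> u; rewrite conjg1 -{2}[u]s'K /=.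
exact: (@eq_mult _ (phi \o t) (phi \o s)).
Qed.

(** Composing a lift of [E12 1] with the inverse transvection [d] gives an automorphism with trivial
    matrix, hence an inner one. So the lift sends [geny] to a conjugate of [genx * geny]. *)
Lemma stab_class_E12_1 (gT : groupType) (phi : {multiplicative F2 -> gT}) :
  stab_class phi (E12 1) ->
  exists k, phi genx * phi geny = phi geny ^ k.
Proof.
case/stab_classP => s [k [bs sT sE]].
pose d : {multiplicative F2 -> F2} := lift2 (genx, genx^-1 * geny).
have bd : bijective d.
  by apply: (@bij_lift2 _ (genx, genx * geny));
    rewrite /= ?multM ?multV ?lift2x ?lift2y /= ?mulKg ?mulVKg.
have dT : ab_mx d = E12 (-1).
  apply/matrixP => i j; rewrite !mxE.
  have [->|->] := ord2P j; rewrite -/genx -/geny ?lift2x ?lift2y /=;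
    by have [->|->] := ord2P i; rewrite ?expsumM ?expsumV ?expsum_gen /=; ring.
have [|h hE] := @ab_mx1_inner (s \o d) (bij_comp bs bd).
  rewrite (@ab_mxM s d) // sT dT -[LHS]/(slmx (E12 1 * E12 (-1))).
  by rewrite -E12D subrr E12_0.
have sy : s geny = (genx * geny) ^ h.
  by rewrite -hE /=; congr (s _); rewrite multM lift2x lift2y mulVKg.
by exists (k * (phi h)^-1); rewrite conjgM -sE sy multJ conjgK multM.
Qed.

(** * The stabilizer for pairwise coprime orders *)

Section CoprimeOrders.
Variables (gT : finGroupType) (a b : gT) (phi : {multiplicative F2 -> gT}).
Hypotheses (ab : coprime #[a] #[b]) (aab : coprime #[a] #[a * b])
  (bab : coprime #[b] #[a * b]) (phix : phi genx = a) (phiy : phi geny = b).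

Lemma sl_red_stab_class n (A : SL2 (zmod n)) :
  exists2 g, stab_class phi g & sl_red n g = A.
Proof.
(* [zmod 0] is the same ring as [zmod 1]. *)
wlog n_gt0 : n A / (0 < n)%N.
  move=> main; case: n A => [|n] A; last exact: main.
  have [g Gg gA] := main 1%N A isT; exists g => //.
  by apply: val_inj; rewrite -gA.
apply: (unipotents_generate n_gt0 (order_gt0 a) (order_gt0 b)
  (order_gt0 (a * b)) ab aab bab
  (subgroup_red n (subgroup_stab_class phi))).
- exists (E12 #[a]%:R%R); last exact: sl_red_E12.
  by apply: stab_class_E12; rewrite phix expg_order.
- exists (E21 #[b]%:R%R); last exact: sl_red_E21.
  by apply: stab_class_E21; rewrite phiy expg_order.
- exists (E11 #[a * b]%:R%R); last exact: sl_red_E11.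
  by apply: stab_class_E11; rewrite multM phix phiy expg_order.
Qed.

Lemma congruence_stab_class_eq1 : congruence (stab_class phi) -> a = 1 /\ b = 1.
Proof.
case=> _ [n n_gt0 ker_n].
(* [g] is an element of the stabilizer congruent to [E12 1]; their quotient lies in the kernel of
   reduction, so [E12 1] stabilizes the class too. *)
have [g Gg gT'] := sl_red_stab_class (sl_red n (E12 1)).
have /stab_class_E12_1[k] : stab_class phi (E12 1).
  rewrite -[E12 1](mulgVK g).
  apply: (subgroupM (subgroup_stab_class phi)) => //.
  by apply: ker_n; rewrite sl_redM sl_redV gT' mulgV.
rewrite phix phiy => E; move: aab bab; rewrite E orderJ => ab1.
rewrite /coprime gcdnn order_eq1 => /eqP b1; split=> //.
by move: E; rewrite b1 mulg1 conj1g.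
Qed.

End CoprimeOrders.

Theorem theorem4p4p10 (gT : finGroupType) (a b : gT)
    (phi : {multiplicative F2 -> gT}) :
  [set: gT] != 1 ->
  <<[set a; b]>> = [set: gT] ->
  coprime #[a] #[b] -> coprime #[a] #[a * b] -> coprime #[b] #[a * b] ->
  phi genx = a -> phi geny = b ->
  totally_noncongruence (stab_class phi).
Proof.
move=> nontriv gen_ab ab aab bab phix phiy; split.
  split; first exact: finite_index_stab_class.
  move=> /(congruence_stab_class_eq1 ab aab bab phix phiy)[a1 b1].
  case/negP: nontriv; rewrite -gen_ab a1 b1 finset.setUid.
  by rewrite -[<<_>>]/<[1]> cycle1.
(* Surjectivity holds modulo every [n], in particular at the level, whatever its value. *)
rewrite /level_index; set n := level _.
suff -> : red_pm n (stab_class phi) = [set: SL2 (zmod n)] by apply: indexgg.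
apply/setP => A; rewrite !inE; apply/asboolP.
have [g Gg gA] := sl_red_stab_class ab aab bab phix phiy A.
by exists g => // H [_]; apply; left.
Qed.
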